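(* A set $\mathcal{F}$ of two (non-isomorphic) graphs is dominance monotone if and only if one of the following holds: (i) $\mathcal{F}$ contains one of $K_1$, $2K_1$, or $K_2$; (ii) $\mathcal{F}$ is one of $\{K_2+K_1,P_3\}$, $\{K_2+K_1,C_4\}$, or $\{2K_2,P_3\}$.
   Context: All graphs are finite and simple, up to isomorphism; $K_n,C_n,P_n$ are the complete graph, cycle and path on $n$ vertices; $G+H$ is the disjoint union and $aG$ the disjoint union of $a$ copies of $G$. For lists $d=(d_1,\dots,d_n)$ and $e=(e_1,\dots,e_p)$ of positive integers in nonincreasing order, $d\succeq e$ if $\sum d_i=\sum e_i$ and $\sum_{i=1}^k e_i\le\sum_{i=1}^k d_i$ for $1\le k\le\min\{p,n\}$. A graph is $\mathcal{F}$-free if no induced subgraph is isomorphic to an element of $\mathcal{F}$; a degree sequence is forcibly $\mathcal{F}$-free if every realization (graph with that degree sequence) is $\mathcal{F}$-free. $\mathcal{F}$ is dominance monotone if whenever $d,e$ are degree sequences with positive terms, $d\succeq e$, and $e$ is forcibly $\mathcal{F}$-free, then $d$ is forcibly $\mathcal{F}$-free. *)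

(* Defs.v *)
From mathcomp Require Import all_boot.

Set Implicit Arguments.
Unset Strict Implicit.
Unset Printing Implicit Defensive.

Record sgraph := SGraph {
  vertex :> finType;
  adj : rel vertex;
  adj_sym : symmetric adj;
  adj_irr : irreflexive adj }.

Arguments adj {s} x y.

Definition iso (G H : sgraph) : Prop :=
  exists2 f : G -> H, bijective f & forall x y, adj (f x) (f y) = adj x y.

Section Constructions.

Definition complete_adj n : rel 'I_n := fun x y => x != y.

Fact complete_sym n : symmetric (@complete_adj n).
Proof. by move=> x y; rewrite /complete_adj eq_sym. Qed.

Fact complete_irr n : irreflexive (@complete_adj n).
Proof. by move=> x; rewrite /complete_adj eqxx. Qed.

Definition K_ n : sgraph := SGraph (@complete_sym n) (@complete_irr n).

(* The conjunct [x != y] only matters for [n = 1]; this is the cycle on [n]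
   vertices for [n >= 3]. *)
Definition cycle_adj n : rel 'I_n :=
  fun x y => (x != y) && ((x.+1 %% n == y) || (y.+1 %% n == x)).

Fact cycle_sym n : symmetric (@cycle_adj n).
Proof. by move=> x y; rewrite /cycle_adj eq_sym orbC. Qed.

Fact cycle_irr n : irreflexive (@cycle_adj n).
Proof. by move=> x; rewrite /cycle_adj eqxx. Qed.

Definition C_ n : sgraph := SGraph (@cycle_sym n) (@cycle_irr n).

Definition path_adj n : rel 'I_n :=
  fun x y => (x.+1 == y :> nat) || (y.+1 == x :> nat).

Fact path_sym n : symmetric (@path_adj n).
Proof. by move=> x y; rewrite /path_adj orbC. Qed.

Fact path_irr n : irreflexive (@path_adj n).
Proof. by move=> x; rewrite /path_adj orbb gtn_eqF. Qed.

Definition P_ n : sgraph := SGraph (@path_sym n) (@path_irr n).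

Definition dunion_adj (G H : sgraph) : rel (G + H) := fun u v =>
  match u, v with
  | inl x, inl y => adj x y
  | inr x, inr y => adj x y
  | _, _ => false
  end.

Fact dunion_sym G H : symmetric (@dunion_adj G H).
Proof. by move=> [x|x] [y|y] //=; rewrite adj_sym. Qed.

Fact dunion_irr G H : irreflexive (@dunion_adj G H).
Proof. by move=> [x|x] /=; rewrite adj_irr. Qed.

Definition dunion (G H : sgraph) : sgraph :=
  SGraph (@dunion_sym G H) (@dunion_irr G H).

Definition copies_adj a (G : sgraph) : rel ('I_a * G) :=
  fun u v => (u.1 == v.1) && adj u.2 v.2.

Fact copies_sym a G : symmetric (@copies_adj a G).
Proof. by move=> u v; rewrite /copies_adj eq_sym adj_sym. Qed.

Fact copies_irr a G : irreflexive (@copies_adj a G).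
Proof. by move=> u; rewrite /copies_adj adj_irr andbF. Qed.

Definition copies a (G : sgraph) : sgraph :=
  SGraph (@copies_sym a G) (@copies_irr a G).

Definition induced_adj (G : sgraph) (S : {set G}) : rel {x : G | x \in S} :=
  fun u v => adj (val u) (val v).

Fact induced_sym G S : symmetric (@induced_adj G S).
Proof. by move=> u v; rewrite /induced_adj adj_sym. Qed.

Fact induced_irr G S : irreflexive (@induced_adj G S).
Proof. by move=> u; rewrite /induced_adj adj_irr. Qed.

Definition induced (G : sgraph) (S : {set G}) : sgraph :=
  SGraph (@induced_sym G S) (@induced_irr G S).

End Constructions.

(* A set of graphs up to isomorphism is a predicate on [sgraph]; the two-element
   set {G1, G2} is therefore the union of two isomorphism classes. *)
Definition pair_family (G1 G2 : sgraph) : sgraph -> Prop :=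
  fun H => iso H G1 \/ iso H G2.

Definition same_family (F F' : sgraph -> Prop) : Prop :=
  forall H, F H <-> F' H.

Definition family_free (F : sgraph -> Prop) (G : sgraph) : Prop :=
  forall (S : {set G}) (H : sgraph), F H -> ~ iso (induced S) H.

Definition degree (G : sgraph) (x : G) : nat := #|[set y : G | adj x y]|.

Definition degree_seq (G : sgraph) : seq nat :=
  sort geq [seq degree x | x <- enum G].

Definition realizes (G : sgraph) (d : seq nat) : Prop := degree_seq G = d.

Definition is_degree_seq (d : seq nat) : Prop := exists G, realizes G d.

Definition positive_terms (d : seq nat) : bool := all (fun m => 0 < m) d.

(* Meaningful for nonincreasing lists of positive integers. *)
Definition dominates (d e : seq nat) : Prop :=
  sumn d = sumn e /\
  forall k, 1 <= k <= minn (size e) (size d) ->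
    sumn (take k e) <= sumn (take k d).

Definition forcibly_free (F : sgraph -> Prop) (d : seq nat) : Prop :=
  forall G, realizes G d -> family_free F G.

Definition dominance_monotone (F : sgraph -> Prop) : Prop :=
  forall d e : seq nat,
    is_degree_seq d -> positive_terms d ->
    is_degree_seq e -> positive_terms e ->
    dominates d e -> forcibly_free F e -> forcibly_free F d.

(* Main.v *)
Require Import Defs.
From mathcomp Require Import all_boot.
From mathcomp Require Import zify.

(* Sufficiency: in each listed case a family-free graph without isolated
   vertices is a complete split graph, and degree sequences of such graphs are
   maximal in the dominance order, so [d = e].
   Necessity: take both members to have at least three vertices. The sequences
   of [mK_2] and of complements of matchings have all their realizations of
   these shapes and lie below sequences realized by graphs containing any
   prescribed induced subgraph. So one member has maximum degree at most 1,
   and one has a complement of maximum degree at most 1; with at least three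
   vertices they cannot coincide. Call them [F1] and [F2]. Comparing [2K_2]
   with [P_3], a cycle [C_n.+1] with [C_n] plus a pendant vertex ([n = 3, 4]),
   and [F1] plus a vertex [v] with the graph obtained by shifting one unit of
   degree away from [v] leaves only the listed families. *)

Set Implicit Arguments.
Unset Strict Implicit.
Unset Printing Implicit Defensive.

(** * Dominance criteria and degree sequences *)

(** For any [t], the first [k] terms of a list sum to at most [k * t] plus the total truncated
    excess over [t]. Equality holds for nonincreasing [d] when [t] separates its first [k] terms
    from the rest, so comparing excesses compares prefix sums. *)
Lemma dominates_excess (d e : seq nat) :
  sorted geq d -> sumn d = sumn e ->
  (forall t, \sum_(m <- e) (m - t) <= \sum_(m <- d) (m - t)) ->
  dominates d e.
Proof.
move=> sd eq_sum le_exc; split=> // k /andP[_]; rewrite leq_min => /andP[ke kd].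
(* The term just after the first [k]: those before it are at least [t], those from it on at most
   [t]. The default 0 covers [k = size d]. *)
pose t := nth 0 d k.
have le_take : sumn (take k e) <= k * t + \sum_(m <- e) (m - t).
  rewrite -{2}(cat_take_drop k e) big_cat /= addnA (leq_trans _ (leq_addr _ _)) //.
  rewrite -{2}(size_takel ke).
  elim: (take k e) => [|m s IHs] /=; first by rewrite big_nil.
  by rewrite big_cons; lia.
apply: leq_trans le_take (leq_trans (leq_add (leqnn _) (le_exc t)) _).
have geqT : transitive geq by move=> x y z /= yx /leq_trans; apply.
have sd_nth := sorted_leq_nth geqT (leqnn : reflexive geq) 0 sd.
rewrite -{1}(cat_take_drop k d) big_cat /= [X in _ + (_ + X)]big_seq.
rewrite [X in _ + (_ + X)]big1 ?addn0 => [|m /(nthP 0)[i]]; last first.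
  rewrite size_drop ltn_subRL nth_drop => lt_i <-; apply/eqP; rewrite subn_eq0.
  apply: sd_nth; rewrite ?inE ?leq_addr //; exact: leq_ltn_trans (leq_addr _ _) lt_i.
have : all (fun m => t <= m) (take k d).
  apply/(all_nthP 0) => i; rewrite size_takel // => lt_ik.
  rewrite nth_take // /t; case: (ltnP k (size d)) => kd'.
    by apply: sd_nth; rewrite ?inE; lia.
  by rewrite nth_default.
rewrite -{2}(size_takel kd).
elim: (take k d) => [|m s IHs] /=; first by rewrite big_nil mul0n.
by case/andP=> tm /IHs; rewrite big_cons; lia.
Qed.

Section DegreeSequences.

Implicit Types G H : sgraph.

Lemma perm_degree_seq G : perm_eq (degree_seq G) [seq degree x | x <- enum G].
Proof. by rewrite /degree_seq perm_sort. Qed.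

Lemma sorted_degree_seq G : sorted geq (degree_seq G).
Proof. by apply: sort_sorted => m n /=; apply: leq_total. Qed.

Lemma sum_degree_seq G (P : nat -> nat) :
  \sum_(m <- degree_seq G) P m = \sum_(x : G) P (degree x).
Proof. by rewrite (perm_big _ (perm_degree_seq G)) big_map big_enum. Qed.

Lemma sum_degree_fun G H (P : nat -> nat) : degree_seq G = degree_seq H ->
  \sum_(x : G) P (degree x) = \sum_(x : H) P (degree x).
Proof. by rewrite -!sum_degree_seq => ->. Qed.

Lemma all_degree_seq G (p : pred nat) :
  all p (degree_seq G) = [forall x : G, p (degree x)].
Proof.
rewrite (perm_all _ (perm_degree_seq G)) all_map.
by apply/allP/forallP => [pG x | pG x _]; [apply: pG; rewrite mem_enum | apply: pG].
Qed.

Lemma degree_seq_forall G H (p : pred nat) : degree_seq G = degree_seq H ->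
  (forall x : H, p (degree x)) -> forall x : G, p (degree x).
Proof.
move=> eqGH pH; apply/forallP; rewrite -all_degree_seq eqGH all_degree_seq.
exact/forallP.
Qed.

Lemma size_degree_seq G : size (degree_seq G) = #|G|.
Proof. by rewrite size_sort size_map -cardE. Qed.

Lemma degree_seq_card G H : degree_seq G = degree_seq H -> #|G| = #|H|.
Proof. by rewrite -!size_degree_seq => ->. Qed.

Lemma dominates_degree_seq G H :
  \sum_(x : G) degree x = \sum_(x : H) degree x ->
  (forall t, \sum_(x : H) (degree x - t) <= \sum_(x : G) (degree x - t)) ->
  dominates (degree_seq G) (degree_seq H).
Proof.
move=> eq_sum le_exc; apply: dominates_excess (sorted_degree_seq G) _ _ => [|t].
  by rewrite !sumnE (sum_degree_seq G id) (sum_degree_seq H id).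
by rewrite (sum_degree_seq G (subn^~ t)) (sum_degree_seq H (subn^~ t)).
Qed.

(** For [t <= r] truncation changes nothing on [H], whose excess is the common sum minus [#|H| * t];
    this is at most the excess of [G] because [#|G| <= #|H|]. For [t > r] the excess of [H]
    vanishes. *)
Lemma dominates_near_regular G H r : #|G| <= #|H| ->
  \sum_(x : G) degree x = \sum_(x : H) degree x ->
  (forall x : H, r <= degree x <= r.+1) ->
  dominates (degree_seq G) (degree_seq H).
Proof.
move=> le_card eq_sum near_r; apply: dominates_degree_seq => // t.
have [le_tr | lt_rt] := leqP t r; last first.
  by rewrite big1 // => x _; have := near_r x; lia.
have eH : \sum_(x : H) degree x = \sum_(x : H) (degree x - t) + #|H| * t.
  rewrite -sum_nat_const -big_split /=; apply: eq_bigr => x _.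
  by have := near_r x; lia.
have : \sum_(x : G) degree x <= \sum_(x : G) (degree x - t) + #|G| * t.
  by rewrite -sum_nat_const -big_split /=; apply: leq_sum => x _; lia.
by nia.
Qed.

End DegreeSequences.

(** * Induced subgraphs as embeddings *)

(** Containment as an induced subgraph, given by a map instead of a vertex set so that containments
    compose. *)
Definition embeds (H G : sgraph) : Prop :=
  exists2 f : H -> G, injective f & forall x y, adj (f x) (f y) = adj x y.

Section Embeddings.

Implicit Types F G H : sgraph.

Lemma embeds_trans F G H : embeds F G -> embeds G H -> embeds F H.
Proof.
move=> [f injf adjf] [g injg adjg].
by exists (g \o f) => [|x y]; [apply: inj_comp | rewrite /= adjg adjf].
Qed.

Lemma iso_embeds G H : iso G H -> embeds G H.
Proof. by case=> f /bij_inj injf adjf; exists f. Qed.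

Lemma embeds_iso G H : embeds G H -> #|H| <= #|G| -> iso G H.
Proof. by case=> f injf adjf leHG; exists f => //; apply: inj_card_bij. Qed.

Lemma iso_sym G H : iso G H -> iso H G.
Proof.
case=> f [g fK gK] adjf; exists g => [|x y]; first by exists f.
by rewrite -adjf !gK.
Qed.

Lemma iso_trans F G H : iso F G -> iso G H -> iso F H.
Proof.
move=> [f bijf adjf] [g bijg adjg].
by exists (g \o f) => [|x y]; [apply: bij_comp | rewrite /= adjg adjf].
Qed.

Lemma induced_embeds G H (S : {set G}) : iso (induced S) H -> embeds H G.
Proof.
move=> /iso_sym[f /bij_inj injf adjf].
by exists (val \o f) => [|x y]; [apply: inj_comp (@val_inj _ _ _) injf | apply: adjf].
Qed.

Lemma embeds_induced G H : embeds H G -> exists S : {set G}, iso (induced S) H.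
Proof.
case=> f injf adjf; exists (f @: [set: H]); apply: iso_sym.
pose g x : induced (f @: [set: H]) := exist _ (f x) (imset_f f (in_setT x)).
apply: embeds_iso; first by exists g => [x y [/injf]|x y] //; apply: adjf.
by rewrite card_sig card_imset // cardsT.
Qed.

Lemma family_freeP (F : sgraph -> Prop) G :
  family_free F G <-> forall H, F H -> ~ embeds H G.
Proof.
split=> [freeG H FH /embeds_induced[S]|freeG S H FH /induced_embeds]; first exact: freeG.
exact: freeG.
Qed.

Lemma embeds_degree H G (f : H -> G) x : injective f ->
  (forall x y, adj (f x) (f y) = adj x y) -> degree x <= degree (f x).
Proof.
move=> injf adjf; rewrite /degree -(card_imset _ injf); apply: subset_leq_card.
by apply/subsetP=> _ /imsetP[y + ->]; rewrite !inE adjf.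
Qed.

End Embeddings.

Section SmallGraphs.

Variable G : sgraph.
Implicit Types x y z t : G.

Lemma adj_neq x y : adj x y -> x != y.
Proof. by apply: contraTneq => ->; rewrite adj_irr. Qed.

Lemma embeds_K1 x : embeds (K_ 1) G.
Proof. by exists (fun=> x) => [i j _|i j]; rewrite !ord1 // !adj_irr. Qed.

Lemma embeds_K2 x y : adj x y -> embeds (K_ 2) G.
Proof.
move=> xy; have nxy := adj_neq xy.
exists (fun i : 'I_2 => nth x [:: x; y] i) => [i j|i j].
  case: i j => [[|[|//]] ?] [[|[|//]] ?] //= eq_f; apply: val_inj => //=;
    by rewrite eq_f eqxx in nxy.
by case: i j => [[|[|//]] ?] [[|[|//]] ?]; rewrite /= ?adj_irr ?xy // adj_sym xy.
Qed.

Lemma embeds_2K1 x y : x != y -> ~~ adj x y -> embeds (copies 2 (K_ 1)) G.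
Proof.
move=> nxy /negbTE xy.
exists (fun i : 'I_2 * 'I_1 => nth x [:: x; y] i.1) => [i j|i j].
  case: i j => [[[|[|//]] ?] i] [[[|[|//]] ?] j] /= eq_f; rewrite ?(ord1 i) ?(ord1 j);
    try (by congr pair; apply: val_inj); by rewrite eq_f eqxx in nxy.
case: i j => [[[|[|//]] ?] i] [[[|[|//]] ?] j];
  by rewrite /= /copies_adj /= ?(ord1 i) ?(ord1 j) ?andbF ?adj_irr ?xy // adj_sym.
Qed.

Lemma embeds_K2K1 x y z : adj x y -> z != x -> z != y ->
  ~~ adj z x -> ~~ adj z y -> embeds (dunion (K_ 2) (K_ 1)) G.
Proof.
move=> xy zx zy /negbTE nzx /negbTE nzy; have nxy := adj_neq xy.
have yx : adj y x by rewrite adj_sym.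
have nxz : adj x z = false by rewrite adj_sym.
have nyz : adj y z = false by rewrite adj_sym.
exists (fun i : 'I_2 + 'I_1 => if i is inl i then nth x [:: x; y] i else z).
  move=> [[[|[|//]] ?]|i] [[[|[|//]] ?]|j] /= eq_f;
    try (by congr inl; apply: val_inj); try (by rewrite ?(ord1 i) ?(ord1 j));
    by rewrite eq_f eqxx in nxy zx zy.
by move=> [[[|[|//]] ?]|[[|//] ?]] [[[|[|//]] ?]|[[|//] ?]];
  rewrite /= ?adj_irr ?xy ?yx ?nxz ?nyz ?nzx ?nzy.
Qed.

Lemma embeds_P3 x y z : adj x y -> adj y z -> x != z -> ~~ adj x z ->
  embeds (P_ 3) G.
Proof.
move=> xy yz nxz /negbTE xz; have [nxy nyz] := (adj_neq xy, adj_neq yz).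
have yx : adj y x by rewrite adj_sym.
have zy : adj z y by rewrite adj_sym.
have zx : adj z x = false by rewrite adj_sym.
exists (fun i : 'I_3 => nth x [:: x; y; z] i).
  move=> [[|[|[|//]]] ?] [[|[|[|//]]] ?] /= eq_f; apply: val_inj => //=;
    by rewrite eq_f eqxx in nxy nyz nxz.
by move=> [[|[|[|//]]] ?] [[|[|[|//]]] ?]; rewrite /= ?adj_irr ?xy ?yx ?xz ?yz ?zx ?zy.
Qed.

Lemma embeds_C4 x y z t : adj x y -> adj y z -> adj z t -> adj t x ->
  x != z -> y != t -> ~~ adj x z -> ~~ adj y t -> embeds (C_ 4) G.
Proof.
move=> xy yz zt tx nxz nyt /negbTE xz /negbTE yt.
have [[nxy nyz] [nzt ntx]] := (adj_neq xy, adj_neq yz, (adj_neq zt, adj_neq tx)).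
have yx : adj y x by rewrite adj_sym.
have zy : adj z y by rewrite adj_sym.
have tz : adj t z by rewrite adj_sym.
have xt : adj x t by rewrite adj_sym.
have zx : adj z x = false by rewrite adj_sym.
have ty : adj t y = false by rewrite adj_sym.
exists (fun i : 'I_4 => nth x [:: x; y; z; t] i).
  move=> [[|[|[|[|//]]]] ?] [[|[|[|[|//]]]] ?] /= eq_f; apply: val_inj => //=;
    by rewrite eq_f eqxx in nxy nyz nxz nzt ntx nyt.
by move=> [[|[|[|[|//]]]] ?] [[|[|[|[|//]]]] ?];
  rewrite /= ?adj_irr ?xy ?yx ?xz ?yz ?zx ?zy ?zt ?tz ?tx ?xt ?ty ?yt.
Qed.

Lemma embeds_2K2 x y z t : adj x y -> adj z t ->
  x != z -> x != t -> y != z -> y != t ->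
  ~~ adj x z -> ~~ adj x t -> ~~ adj y z -> ~~ adj y t ->
  embeds (copies 2 (K_ 2)) G.
Proof.
move=> xy zt nxz nxt nyz nyt /negbTE xz /negbTE xt /negbTE yz /negbTE yt.
have [nxy nzt] := (adj_neq xy, adj_neq zt).
have [yx tz] : adj y x /\ adj t z by split; rewrite adj_sym.
have [zx tx] : adj z x = false /\ adj t x = false by split; rewrite adj_sym.
have [zy ty] : adj z y = false /\ adj t y = false by split; rewrite adj_sym.
exists (fun i : 'I_2 * 'I_2 => nth x (nth [::] [:: [:: x; y]; [:: z; t]] i.1) i.2).
  move=> [[[|[|//]] ?] [[|[|//]] ?]] [[[|[|//]] ?] [[|[|//]] ?]] /= eq_f;
    try (by congr pair; apply: val_inj); by rewrite eq_f eqxx in nxy nzt nxz nxt nyz nyt.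
by move=> [[[|[|//]] ?] [[|[|//]] ?]] [[[|[|//]] ?] [[|[|//]] ?]];
  rewrite /= /copies_adj /= /complete_adj /= ?adj_irr
    ?xy ?yx ?xz ?yz ?zx ?zy ?zt ?tz ?tx ?xt ?ty ?yt.
Qed.

End SmallGraphs.

(** * Complete split graphs and sufficiency *)

Lemma degree_lt (G : sgraph) (x : G) : degree x < #|G|.
Proof.
rewrite /degree -cardsT; apply: proper_card; apply/properP; split=> //.
by exists x; rewrite ?inE ?adj_irr.
Qed.

(** The join of a clique on [S] with an independent set on the remaining vertices. *)
Definition complete_split (G : sgraph) : Prop :=
  exists S : {set G}, forall x y, adj x y = (x != y) && ((x \in S) || (y \in S)).

(** Take for [S] the vertices adjacent to all others. If an edge [xy] misses [S], with
    non-neighbours [x'] of [x] and [y'] of [y], then excluding $K_2+K_1$ makes [x], [y], [x'], [y']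
    an induced 4-cycle. *)
Lemma complete_split_free (G : sgraph) :
  ~ embeds (dunion (K_ 2) (K_ 1)) G -> ~ embeds (C_ 4) G -> complete_split G.
Proof.
move=> noK2K1 noC4; exists [set x | [forall y, (y != x) ==> adj x y]] => x y.
have [-> | nxy] /= := eqVneq x y; first exact: adj_irr.
rewrite !inE; apply/idP/orP => [xy | []]; last first.
- by move=> /forallP/(_ x); rewrite nxy adj_sym.
- by move=> /forallP/(_ y); rewrite eq_sym nxy.
apply/orP; apply: contraPT xy; rewrite negb_or !negb_forall => /andP[].
move=> /existsP[x'] + /existsP[y']; rewrite !negb_imply.
move=> /andP[nx'x nxx'] /andP[ny'y nyy'] xy.
have K2K1_free (a b c : G) : adj a b -> c != a -> c != b -> ~~ adj c a -> adj c b.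
  move=> ab nca ncb nac; apply/negPn/negP => nbc; apply: noK2K1.
  by apply: (embeds_K2K1 ab nca ncb).
have nx'y : x' != y by apply: contraNneq nxx' => ->.
have ny'x : y' != x by apply: contraNneq nyy' => ->; rewrite adj_sym.
have x'y : adj x' y by apply: K2K1_free xy _ _ _; rewrite // adj_sym.
have y'x : adj y' x.
  by apply: (K2K1_free y x y'); rewrite // adj_sym.
have nx'y' : x' != y' by apply: contraNneq nyy' => <-; rewrite adj_sym.
have x'y' : adj x' y' by apply: (K2K1_free x); rewrite // adj_sym.
by apply: noC4; apply: (@embeds_C4 _ x y x' y');
  rewrite // 1?adj_sym // 1?eq_sym // adj_sym.
Qed.

Lemma all_leq_sum_eq r (s : seq nat) :
  all (fun m => m <= r) s -> size s * r <= sumn s -> s = nseq (size s) r.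
Proof.
elim: s => //= m s IHs /andP[le_mr le_sr] le_sum.
have : sumn s <= size s * r.
  elim: s le_sr {IHs le_sum} => //= m' s IHs /andP[? /IHs]; lia.
by move=> ?; rewrite -IHs //; [congr cons; lia | lia].
Qed.

Lemma all_geq_sum_eq r (s : seq nat) :
  all (fun m => r <= m) s -> sumn s <= size s * r -> s = nseq (size s) r.
Proof.
elim: s => //= m s IHs /andP[le_mr le_sr] le_sum.
have : size s * r <= sumn s.
  elim: s le_sr {IHs le_sum} => //= m' s IHs /andP[? /IHs]; lia.
by move=> ?; rewrite -IHs //; [congr cons; lia | lia].
Qed.

Lemma degree_seq_complete_split (G : sgraph) (S : {set G}) :
  (forall x y, adj x y = (x != y) && ((x \in S) || (y \in S))) ->
  degree_seq G = nseq #|S| #|G|.-1 ++ nseq (#|G| - #|S|) #|S|.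
Proof.
move=> adjG.
have degS x : x \in S -> degree x = #|G|.-1.
  move=> Sx; rewrite -(cardsC1 x); apply: eq_card => y.
  by rewrite !inE adjG Sx andbT eq_sym.
have degNS x : x \notin S -> degree x = #|S|.
  move=> nSx; apply: eq_card => y; rewrite inE adjG (negbTE nSx) /=.
  by apply: andb_idl; apply: contraTneq => <-.
have geqT : transitive geq by move=> x y z /= yx /leq_trans; apply.
have geq_anti : antisymmetric geq by move=> x y /= ?; apply/eqP; rewrite eqn_leq andbC.
apply: (sorted_eq geqT geq_anti (sorted_degree_seq G)).
  rewrite (sorted_pairwise geqT) pairwise_cat.
  apply/and3P; split.
  - apply/allrelP => a b /nseqP[-> gt0S] /nseqP[-> +] /=.
    by rewrite subn_gt0 => lt_S; rewrite -ltnS (ltn_predK lt_S).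
  - by elim: #|S| => //= n ->; rewrite andbT; rewrite all_nseq /= leqnn orbT.
  by elim: (#|G| - _) => //= n ->; rewrite andbT; rewrite all_nseq /= leqnn orbT.
apply: perm_trans (perm_degree_seq G) _.
have enumE : perm_eq (enum G) (enum S ++ enum (~: S)).
  apply: uniq_perm; rewrite ?enum_uniq // ?cat_uniq ?enum_uniq ?andbT /=.
    by apply/hasPn => x; rewrite !mem_enum !inE.
  by move=> x; rewrite mem_cat !mem_enum !inE orbN.
apply: perm_trans (perm_map _ enumE) _; rewrite map_cat.
have mapE (A : {set G}) r : {in A, forall x, degree x = r} ->
    [seq degree x | x <- enum A] = nseq #|A| r.
  move=> degA; rewrite cardE -(size_map (@degree G)); apply/all_pred1P/allP => m.
  by case/mapP=> x; rewrite mem_enum => /degA <- ->; apply: eqxx.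
have degC : {in ~: S, forall x, degree x = #|S|}.
  by move=> x; rewrite inE => /degNS.
have cardC : #|~: S| = #|G| - #|S| by rewrite cardsCs setCK.
by rewrite (mapE _ _ degS) (mapE _ _ degC) cardC.
Qed.

(* Complete split graphs are threshold graphs, and threshold sequences are
   maximal in the dominance order of degree sequences. *)
Lemma complete_split_maximal (D E : sgraph) :
  complete_split E -> positive_terms (degree_seq D) ->
  positive_terms (degree_seq E) ->
  dominates (degree_seq D) (degree_seq E) -> degree_seq D = degree_seq E.
Proof.
move=> [S adjE] posD; have := degree_seq_complete_split adjE.
set d := degree_seq D; set e := degree_seq E; set s := #|S|; set n := #|E|.
move=> eE posE [eq_sum dom].
have le_sn : s <= n by apply: max_card.
have size_e : size e = n by apply: size_degree_seq.
have d_lt : all (fun m => m < size d) d.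
  by rewrite all_degree_seq; apply/forallP=> x; rewrite size_degree_seq degree_lt.
(* With [S] empty all terms of [e] are 0, so positivity leaves only the empty list, and then [d]
   cannot be nonempty either. *)
have [s0 | s_gt0] := posnP s.
  have e_nil : e = [::].
    move: posE; rewrite eE s0 subn0; case: (n) => //= m.
  move: posD eq_sum; rewrite -/d e_nil; case: (d) => //= m d' /andP[]; lia.
(* If [d] were longer than [n], its first [n] terms would already reach the full sum, leaving
   nothing for the positive terms after them. *)
have le_size : size d <= n.
  rewrite leqNgt; apply/negP => lt_nd.
  have := dom n; rewrite size_e (minn_idPl (ltnW lt_nd)) leqnn andbT.
  have take_n : take n e = e by rewrite -size_e take_size.
  rewrite (leq_trans s_gt0 le_sn) take_n -eq_sum => /(_ isT).
  rewrite -{1}(cat_take_drop n d) sumn_cat.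
  have : all (fun m => 0 < m) (drop n d).
    by apply/allP=> m /mem_drop; apply/allP.
  have : size (drop n d) != 0 by rewrite size_drop; lia.
  by case: (drop n d) => //= m d' _ /andP[]; lia.
have sum_take k : k <= size d -> sumn (take k d) <= k * (size d).-1.
  move=> le_kd; rewrite -{2}(size_takel le_kd).
  have : all (fun m => m < size d) (take k d).
    by apply/allP=> m /mem_take /(allP d_lt).
  by elim: (take k d) => //= m d' IH /andP[? /IH]; lia.
have d_gt0 : 0 < size d.
  rewrite lt0n; apply: contraTneq s_gt0 => /size0nil d_nil.
  move: eq_sum posE size_e le_sn; rewrite d_nil.
  case: (e) => [|m e'] /=; first by lia.
  by move=> eq_sum /andP[]; lia.
have take_e k : k <= s -> take k e = nseq k n.-1.
  move=> le_ks; rewrite eE take_cat size_nseq.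
  case: ltngtP le_ks => // [lt_ks | ->] _; first by rewrite take_nseq // ltnW.
  by rewrite subnn take0 cats0.
have size_d : size d = n.
  apply/eqP; rewrite eqn_leq le_size /=.
  (* The first [k] terms equal [n.-1] in [e] and are at most [(size d).-1] in [d]; since [k > 0],
     dominance forces [n <= size d]. *)
  pose k := minn s (size d).
  have k_gt0 : 0 < k by rewrite leq_min s_gt0.
  have := dom k; rewrite k_gt0 leq_min geq_minr size_e.
  rewrite (leq_trans (geq_minl _ _) le_sn) => /(_ isT).
  rewrite take_e ?geq_minl // sumn_nseq => le1.
  have := leq_trans le1 (sum_take k (geq_minr _ _)).
  rewrite mulnC leq_pmul2l //; lia.
have size_take : size (take s d) = s by rewrite size_takel // size_d.
have take_d : take s d = nseq s n.-1.
  rewrite -{2}size_take; apply: all_leq_sum_eq.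
    apply/allP=> m /mem_take /(allP d_lt) /=; lia.
  have := dom s; rewrite s_gt0 size_e size_d minnn le_sn => /(_ isT).
  by rewrite take_e // sumn_nseq size_take mulnC.
(* These [n - s] terms have total [(n - s) * s], so it suffices that each is at least [s]. *)
have drop_d : drop s d = nseq (n - s) s.
  have size_drop_d : size (drop s d) = n - s by rewrite size_drop size_d.
  rewrite -size_drop_d; apply: all_geq_sum_eq; last first.
    move: eq_sum; rewrite -{1}(cat_take_drop s d) eE !sumn_cat take_d.
    rewrite size_drop_d sumn_nseq (sumn_nseq s); lia.
  have [eq_sn | lt_sn] := leqP n s.
    by move: size_drop_d; rewrite (eqP eq_sn) => /size0nil ->.
  apply/allP=> m /mem_drop; move: m; apply/allP.
  rewrite all_degree_seq; apply/forallP => x /=.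
  (* [T] collects the vertices adjacent to all others. By [take_d] there are at least [s] of them,
     and every vertex outside [T] is adjacent to each of them. *)
  pose T := [set y : D | degree y == n.-1].
  have card_D : #|D| = n by rewrite -size_d size_degree_seq.
  have le_sT : s <= #|T|.
    rewrite -sum1_card big_mkcond /= (eq_bigr (fun y => (degree y == n.-1) : nat)).
      rewrite -(sum_degree_seq D (fun m => (m == n.-1) : nat)) -/d.
      rewrite -{1}(cat_take_drop s d) big_cat take_d /= big_nseq.
      by rewrite iter_addn eqxx /= mul1n addn0 leq_addr.
    by move=> y _; rewrite inE; case: eqP.
  have [Tx | nTx] := boolP (x \in T).
    by move: Tx; rewrite inE => /eqP ->; lia.
  apply: leq_trans le_sT _; apply: subset_leq_card; apply/subsetP => y.
  rewrite !inE => /eqP full_y.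
  have nyx : y != x by apply: contraNneq nTx => <-; rewrite inE full_y.
  have : [set z : D | adj y z] == [set~ y].
    rewrite eqEcard cardsC1 card_D -/(degree y) full_y leqnn andbT.
    by apply/subsetP=> z; rewrite !inE eq_sym => /adj_neq.
  by move=> /eqP/setP/(_ x); rewrite !inE eq_sym nyx adj_sym.
by rewrite -(cat_take_drop s d) take_d drop_d eE.
Qed.

Lemma dominance_monotone_complete_split (F : sgraph -> Prop) :
  (forall G, positive_terms (degree_seq G) -> family_free F G ->
    complete_split G) ->
  dominance_monotone F.
Proof.
move=> splitF d e [D <-] posD [E <-] posE dom freeE.
suffices -> : degree_seq D = degree_seq E by [].
by apply: complete_split_maximal => //; apply: splitF => //; apply: freeE.
Qed.

Lemma complete_split_family (F : sgraph -> Prop) :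
  (F (K_ 1) \/ F (copies 2 (K_ 1)) \/ F (K_ 2)) \/
  (F (dunion (K_ 2) (K_ 1)) /\ (F (P_ 3) \/ F (C_ 4)) \/
   F (copies 2 (K_ 2)) /\ F (P_ 3)) ->
  dominance_monotone F.
Proof.
move=> inF; apply: dominance_monotone_complete_split => G posG /family_freeP freeG.
have {}freeG H : embeds H G -> ~ F H by move=> embH FH; apply: freeG embH.
have nbr (x : G) : exists y, adj x y.
  have := posG; rewrite /positive_terms all_degree_seq => /forallP/(_ x).
  by case/card_gt0P=> y; rewrite inE; exists y.
(* Forbidding $P_3$ therefore also forbids $C_4$. *)
have C4_P3 : embeds (P_ 3) (C_ 4).
  by apply: (@embeds_P3 (C_ 4) (inord 0) (inord 1) (inord 2));
    rewrite //= /cycle_adj -?val_eqE /= ?inordK.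
(* When $K_1$ or $K_2$ is forbidden, [G] has no vertex at all, since each vertex would have a
   neighbour. *)
have no_edge (x : G) : F (K_ 1) \/ F (K_ 2) -> False.
  have [y xy] := nbr x.
  by case; apply: freeG; [apply: (embeds_K1 x) | apply: (embeds_K2 xy)].
case: inF => [[F1|[F2|F3]] | [[FK2K1 FP]|[F2K2 FP3]]].
- by exists set0 => x; case: (no_edge x); left.
- exists setT => x y; rewrite !inE andbT.
  apply/idP/idP => [/adj_neq // | nxy]; apply/negPn/negP => nadj.
  by apply: (freeG _ (embeds_2K1 nxy nadj)).
- by exists set0 => x; case: (no_edge x); right.
- apply: complete_split_free => [/freeG // | emb4].
  by case: FP; apply: freeG => //; apply: embeds_trans emb4.
apply: complete_split_free => [[f injf adjf] | emb4]; last first.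
  by apply: freeG FP3; apply: embeds_trans emb4.
(* Without induced $P_3$, adjacency is transitive on distinct vertices. The isolated vertex [z] of a
   copy of $K_2+K_1$ has a neighbour [t] in [G], which then cannot be adjacent to [x] or [y]; this
   yields $2K_2$. *)
pose x := f (inl (inord 0)); pose y := f (inl (inord 1)); pose z := f (inr ord0).
have xy : adj x y by rewrite adjf /= /complete_adj -val_eqE /= !inordK.
have [zx zy] : ~~ adj z x /\ ~~ adj z y by rewrite !adjf.
have [nzx nzy] : z != x /\ z != y by rewrite !(inj_eq injf).
have [t zt] := nbr z.
have P3_free (a b c : G) : adj a b -> adj b c -> a != c -> adj a c.
  move=> ab bc nac; apply/negPn/negP => nadj.
  exact: freeG (embeds_P3 ab bc nac nadj) FP3.
have [ntx nty] : t != x /\ t != y.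
  by split; [apply: contraNneq zx => <- | apply: contraNneq zy => <-].
have [tx ty] : ~~ adj t x /\ ~~ adj t y.
  by split; [move: zx | move: zy]; apply: contra => ?; apply: P3_free zt _ _.
by apply: freeG F2K2; apply: (embeds_2K2 xy zt); rewrite 1?eq_sym // 1?adj_sym.
Qed.

(** * Degree counts in graph constructions *)

Lemma exists_notin (T : finType) (s : seq T) : size s < #|T| -> exists x, x \notin s.
Proof.
move=> lt_s; have [x nsx|all_s] := pickP (fun x => x \notin s); first by exists x.
move: lt_s; rewrite ltnNge (leq_trans _ (card_size s)) //.
by apply/subset_leq_card/subsetP => x _; apply/negPn; rewrite all_s.
Qed.

Lemma uniq_size_card (T : finType) (s : seq T) : uniq s -> size s <= #|T|.
Proof. by move/card_uniqP <-; apply: max_card. Qed.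

Section Degrees.

Implicit Types G H : sgraph.

Lemma degreeE G (x : G) : degree x = \sum_y adj x y.
Proof. by rewrite /degree -sum1dep_card big_mkcond. Qed.

Lemma adj_degree1 G (x y z : G) : degree x <= 1 -> adj x y -> adj x z -> y = z.
Proof. by move/card_le1_eqP => eq1 xy xz; apply: eq1; rewrite inE. Qed.

Lemma degree_K n (x : K_ n) : degree x = n.-1.
Proof.
rewrite -[in RHS](card_ord n) -(cardsC1 x); apply: eq_card => y.
by rewrite !inE eq_sym.
Qed.

Lemma degree_C4 (x : C_ 4) : degree x = 2.
Proof. by rewrite degreeE !big_ord_recl big_ord0; case: x => [[|[|[|[|]]]] ?]. Qed.

Lemma degree_C5 (x : C_ 5) : degree x = 2.
Proof. by rewrite degreeE !big_ord_recl big_ord0; case: x => [[|[|[|[|[|]]]]] ?]. Qed.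

Lemma degree_dunion_inl G H (x : G) : degree (inl x : dunion G H) = degree x.
Proof. by rewrite !degreeE big_sumType /= [X in _ + X]big1 // addn0. Qed.

Lemma degree_dunion_inr G H (x : H) : degree (inr x : dunion G H) = degree x.
Proof. by rewrite !degreeE big_sumType /= [X in X + _]big1. Qed.

Lemma degree_copies a G (u : copies a G) : degree u = degree u.2.
Proof.
case: u => i x; rewrite !degreeE.
rewrite -(pair_bigA _ (fun j y => nat_of_bool (@adj (copies a G) (i, x) (j, y)))).
rewrite (bigD1 i) //= [X in _ + X]big1 ?addn0 => [|j nji].
  by apply: eq_bigr => y _; rewrite /copies_adj eqxx.
by rewrite big1 // => y _; rewrite /copies_adj eq_sym (negbTE nji).
Qed.

Lemma sum_degree_dunion G H :
  \sum_(u : dunion G H) degree u = \sum_(x : G) degree x + \sum_(x : H) degree x.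
Proof.
by rewrite big_sumType; congr (_ + _); apply: eq_bigr => x _;
  rewrite ?degree_dunion_inl ?degree_dunion_inr.
Qed.

Lemma sum_degree_copies a G :
  \sum_(u : copies a G) degree u = a * \sum_(x : G) degree x.
Proof.
rewrite (eq_bigr _ (fun u _ => degree_copies u)).
by rewrite -(pair_bigA _ (fun (i : 'I_a) x => degree x)) sum_nat_const card_ord.
Qed.

Lemma card_dunion G H : #|dunion G H| = #|G| + #|H|.
Proof. exact: card_sum. Qed.

Lemma card_copies a G : #|copies a G| = a * #|G|.
Proof. by rewrite card_prod card_ord. Qed.

Lemma sum_degree_regular r G : (forall x : G, degree x = r) ->
  \sum_(x : G) degree x = #|G| * r.
Proof. by move=> regG; rewrite (eq_bigr _ (fun x _ => regG x)) sum_nat_const. Qed.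

End Degrees.

Section Complement.

Variable G : sgraph.

Definition compl_adj : rel G := fun x y => (x != y) && ~~ adj x y.

Fact compl_sym : symmetric compl_adj.
Proof. by move=> x y; rewrite /compl_adj eq_sym adj_sym. Qed.

Fact compl_irr : irreflexive compl_adj.
Proof. by move=> x; rewrite /compl_adj eqxx. Qed.

Definition compl : sgraph := SGraph compl_sym compl_irr.

Lemma degree_compl (x : G) : degree x + degree (x : compl) = #|G|.-1.
Proof.
rewrite !degreeE -big_split /= (bigD1 x) //= /compl_adj eqxx adj_irr add0n.
rewrite (eq_bigr (fun=> 1)) => [|y nyx]; first by rewrite sum1_card cardC1.
by rewrite eq_sym nyx; case: adj.
Qed.

Lemma sum_degree_compl :
  \sum_(x : G) degree x + \sum_(x : compl) degree x = #|G| * #|G|.-1.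
Proof.
rewrite -big_split /= (eq_bigr _ (fun x _ => degree_compl x)) sum_nat_const.
by [].
Qed.

End Complement.

Lemma embeds_compl G H : embeds H G -> embeds (compl H) (compl G).
Proof.
by case=> f injf adjf; exists f => // x y; rewrite /= /compl_adj (inj_eq injf) adjf.
Qed.

Lemma embeds_compl_compl G : embeds G (compl (compl G)).
Proof.
exists id => // x y; rewrite /= /compl_adj /= /compl_adj negb_and !negbK.
by have [-> | _] := eqVneq x y; rewrite ?adj_irr.
Qed.

Lemma embeds_dunion_inl G H : embeds G (dunion G H).
Proof. by exists inl => // x y [->]. Qed.

Lemma embeds_copies a G : 0 < a -> embeds G (copies a G).
Proof.
case: a => // a _; exists (pair ord0) => [x y [] // | x y].
by rewrite /= /copies_adj eqxx.
Qed.

Section Attach.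

Variables (G : sgraph) (S : {set G}).

(** Serves to build dominating graphs: the extension still contains [G], and [S] controls where
    degree is added. *)
Definition attach_adj : rel (unit + G) := fun u v =>
  match u, v with
  | inr x, inr y => adj x y
  | inl _, inr x | inr x, inl _ => x \in S
  | inl _, inl _ => false
  end.

Fact attach_sym : symmetric attach_adj.
Proof. by move=> [u|x] [v|y] //=; apply: adj_sym. Qed.

Fact attach_irr : irreflexive attach_adj.
Proof. by move=> [u|x] //=; apply: adj_irr. Qed.

Definition attach : sgraph := SGraph attach_sym attach_irr.

Lemma embeds_attach : embeds G attach.
Proof. by exists inr => // x y []. Qed.

Lemma card_attach : #|attach| = #|G|.+1.
Proof. by rewrite card_sum card_unit. Qed.

Lemma degree_attach_inl u : degree (inl u : attach) = #|S|.
Proof.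
rewrite degreeE big_sumType /= big1 // -sum1_card [RHS]big_mkcond /=.
by apply: eq_bigr => x _; case: (x \in S).
Qed.

Lemma degree_attach_inr x : degree (inr x : attach) = degree x + (x \in S).
Proof. by rewrite !degreeE big_sumType /= sum_nat_const card_unit mul1n addnC. Qed.

Lemma sum_degree_attach :
  \sum_(u : attach) degree u = \sum_(x : G) degree x + 2 * #|S|.
Proof.
rewrite big_sumType /= (eq_bigr _ (fun u _ => degree_attach_inl u)).
rewrite sum_nat_const card_unit mul1n (eq_bigr _ (fun x _ => degree_attach_inr x)).
rewrite big_split /= mul2n -addnn addnCA; congr (_ + (_ + _)).
by rewrite -sum1_card [RHS]big_mkcond; apply: eq_bigr => x _; case: (x \in S).
Qed.

End Attach.

Section AddEdge.

Variables (G : sgraph) (x y : G).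

(** The guard [x != y] keeps the relation irreflexive for every choice of [x] and [y]. *)
Definition add_edge_adj : rel G := fun u v =>
  adj u v || (x != y) && ((u == x) && (v == y) || (u == y) && (v == x)).

Fact add_edge_sym : symmetric add_edge_adj.
Proof.
by move=> u v; rewrite /add_edge_adj adj_sym orbC [X in _ && (X || _)]andbC;
  rewrite [X in _ && (_ || X)]andbC [X in _ && X]orbC orbC.
Qed.

Fact add_edge_irr : irreflexive add_edge_adj.
Proof.
move=> u; rewrite /add_edge_adj adj_irr /=; apply/negP => /andP[nxy].
by rewrite [X in X || _]andbC orbb => /andP[/eqP-> /eqP eq_yx]; rewrite eq_yx eqxx in nxy.
Qed.

Definition add_edge : sgraph := SGraph add_edge_sym add_edge_irr.

Lemma degree_add_edge (u : G) : x != y -> ~~ adj x y ->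
  degree (u : add_edge) = degree u + (u == x) + (u == y).
Proof.
(* Each indicator on the right is multiplied by a sum equal to 1, which turns the identity into one
   that is checked term by term over [v]. *)
move=> nxy nadj; have single (z : G) : \sum_v (v == z) = 1.
  by rewrite (bigD1 z) //= eqxx big1 ?addn0 // => v /negbTE->.
rewrite -[X in _ + X + _]muln1 -{1}(single y) -[X in _ + X]muln1 -{1}(single x).
rewrite !big_distrr -addnA !degreeE -!big_split /=; apply: eq_bigr => v _.
rewrite /add_edge_adj nxy /=.
have [-> | nux] := eqVneq u x; first rewrite (negbTE nxy) /= orbF addn0 mul1n.
  by have [-> | _] := eqVneq v y; rewrite ?(negbTE nadj) ?orbF ?addn0.
have [-> | nuy] := eqVneq u y; rewrite /= ?orbF ?mul0n ?addn0 // mul1n.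
by have [-> | _] := eqVneq v x; rewrite ?orbF ?addn0 // adj_sym (negbTE nadj).
Qed.

End AddEdge.

Section DeletionCount.

Variables (G H : sgraph) (f : H -> G).
Hypotheses (injf : injective f) (adjf : forall x y, adj (f x) (f y) = adj x y).

Let A := f @: [set: H].

(** Counts ordered adjacent pairs by whether their ends lie in the copy [A] of [H]. Doubling the
    degrees outside [A] counts pairs inside [~: A] twice; the surplus stands on the left to avoid
    subtraction. *)
Lemma sum_degree_embeds :
  \sum_(x : G) degree x + \sum_(x in ~: A) \sum_(y in ~: A) adj x y =
  \sum_(x : H) degree x + 2 * \sum_(x in ~: A) degree x.
Proof.
have degE (x : G) : degree x = \sum_(y in A) adj x y + \sum_(y in ~: A) adj x y.
  rewrite degreeE (bigID (mem A)) /=; congr (_ + _).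
  by apply: eq_bigl => y; rewrite inE.
have sumE (F : G -> nat) : \sum_x F x = \sum_(x in A) F x + \sum_(x in ~: A) F x.
  rewrite (bigID (mem A)) /=; congr (_ + _).
  by apply: eq_bigl => y; rewrite inE.
have sumA (F : G -> nat) : \sum_(x in A) F x = \sum_x F (f x).
  rewrite big_imset /=; first by apply: eq_bigl => x; rewrite inE.
  by move=> x y _ _ /injf.
rewrite sumE !(eq_bigr _ (fun x _ => degE x)) !big_split /=.
rewrite [X in X + _ + _ + _ = _]sumA.
have -> : \sum_x \sum_(y in A) adj (f x) y = \sum_(x : H) degree x.
  by apply: eq_bigr => x _; rewrite sumA degreeE; apply: eq_bigr => y _; rewrite adjf.
have -> : \sum_(x in A) \sum_(y in ~: A) adj x y = \sum_(x in ~: A) \sum_(y in A) adj x y.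
  rewrite exchange_big /=; apply: eq_bigr => x _; apply: eq_bigr => y _.
  by rewrite adj_sym.
by lia.
Qed.

End DeletionCount.

(** Deleting a vertex lowers the degree sum by at most [2 * r]. The inequality between orders makes
    [#|G| - #|H|] a genuine difference. *)
Lemma sum_degree_embeds_leq r (G H : sgraph) : embeds H G ->
  (forall x : G, degree x <= r) ->
  #|H| <= #|G| /\
  \sum_(x : G) degree x <= \sum_(x : H) degree x + 2 * r * (#|G| - #|H|).
Proof.
case=> f injf adjf deg_r; have := sum_degree_embeds injf adjf.
set A := f @: _; have cardA : #|A| = #|H| by rewrite card_imset // cardsT.
have : \sum_(x in ~: A) degree x <= (#|G| - #|H|) * r.
  by rewrite -cardA -(setCK A) -cardsCs setCK -sum_nat_const leq_sum.
by split; [rewrite -cardA max_card | nia].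
Qed.

(** A single vertex outside the copy has no loop, so the count of pairs outside vanishes and the
    formula is exact. *)
Lemma sum_degree_embeds_del1 (G H : sgraph) : embeds H G -> #|G| = #|H|.+1 ->
  exists x : G, \sum_(x : G) degree x = \sum_(x : H) degree x + 2 * degree x.
Proof.
case=> f injf adjf card1; have := sum_degree_embeds injf adjf.
set A := f @: _; have cardA : #|A| = #|H| by rewrite card_imset // cardsT.
have /eqP/cards1P[x ->] : #|~: A| = 1 by rewrite cardsCs setCK cardA card1 subSnn.
by rewrite !big_set1 adj_irr addn0; exists x.
Qed.

(** * Matchings, their complements and recognition of small graphs *)

(** These are the graphs $aK_2+bK_1$; imposed on [compl G], the condition describes complements of
    matchings. *)
Definition max_degree_le1 (G : sgraph) : Prop := forall x : G, degree x <= 1.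

Lemma max_degree_le1_embeds (G H : sgraph) :
  embeds H G -> max_degree_le1 G -> max_degree_le1 H.
Proof.
case=> f injf adjf le1 x.
exact: leq_trans (embeds_degree _ injf adjf) (le1 _).
Qed.

Lemma card_small (H : sgraph) : 0 < #|H| -> #|H| < 3 ->
  [\/ iso H (K_ 1), iso H (copies 2 (K_ 1)) | iso H (K_ 2)].
Proof.
move=> /card_gt0P[x _] lt3.
have [lt2|ge2] := ltnP #|H| 2.
  constructor 1; apply/iso_sym/embeds_iso; first exact: (embeds_K1 x).
  by rewrite card_ord.
have [y] := @exists_notin H [:: x] ge2; rewrite inE eq_sym => nxy.
have [xy|nadj] := boolP (adj x y).
  constructor 3; apply/iso_sym/embeds_iso; first exact: (embeds_K2 xy).
  by rewrite card_ord.
constructor 2; apply/iso_sym/embeds_iso; first exact: (embeds_2K1 nxy nadj).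
by rewrite card_copies card_ord.
Qed.

(** Parity: beside an edge [xy], the third vertex [z] needs a neighbour [t] that would be a fourth
    vertex. *)
Lemma one_regular_card3 (G : sgraph) :
  #|G| = 3 -> max_degree_le1 G -> (forall x : G, 0 < degree x) -> False.
Proof.
move=> card3 le1 gt0.
have nbr (x : G) : exists y, adj x y.
  by have /card_gt0P[y] := gt0 x; rewrite inE; exists y.
have /card_gt0P[x _] : 0 < #|G| by rewrite card3.
have [y xy] := nbr x; have nxy := adj_neq xy.
have [z] := @exists_notin G [:: x; y] ltac:(by rewrite card3).
rewrite !inE negb_or => /andP[nzx nzy]; have [t zt] := nbr z; have nzt := adj_neq zt.
have nxt : x != t.
  apply: contraNneq nzy => eq_xt; rewrite -eq_xt adj_sym in zt.
  by rewrite (adj_degree1 (le1 x) zt xy).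
have nyt : y != t.
  apply: contraNneq nzx => eq_yt; rewrite -eq_yt adj_sym in zt.
  by rewrite adj_sym in xy; rewrite (adj_degree1 (le1 y) zt xy).
have := @uniq_size_card G [:: x; y; z; t]; rewrite card3 /= !inE !negb_or.
by rewrite nxy nxt nyt nzt ![_ == z]eq_sym nzx nzy => /(_ isT).
Qed.

Lemma max_degree_le1_compl_card (G : sgraph) (x : G) :
  max_degree_le1 (compl G) -> #|G| <= degree x + 2.
Proof. by move=> /(_ x); have := degree_compl x; lia. Qed.

(** Every degree is at most 1 and at least [#|G| - 2], so [G] would be 1-regular on three
    vertices. *)
Lemma max_degree_le1_not_compl (G : sgraph) : 2 < #|G| ->
  max_degree_le1 G -> max_degree_le1 (compl G) -> False.
Proof.
move=> gt2 le1 le1c; apply: (@one_regular_card3 G) => // [|x].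
  have /card_gt0P[x _] : 0 < #|G| by lia.
  by have := max_degree_le1_compl_card x le1c; have := le1 x; lia.
by have := max_degree_le1_compl_card x le1c; lia.
Qed.

Section IsoSmall.

Variable G : sgraph.

Lemma iso_K2K1 : #|G| = 3 -> max_degree_le1 G -> 0 < \sum_(x : G) degree x ->
  iso G (dunion (K_ 2) (K_ 1)).
Proof.
move=> card3 le1; rewrite lt0n sum_nat_eq0 => /forallPn[x].
rewrite -lt0n => /card_gt0P[y]; rewrite inE => xy.
have [z] := @exists_notin G [:: x; y] ltac:(by rewrite card3).
rewrite !inE negb_or => /andP[nzx nzy].
apply/iso_sym/embeds_iso; last by rewrite card_dunion !card_ord card3.
apply: (embeds_K2K1 xy nzx nzy); rewrite adj_sym.
  by apply: contra nzy => xz; rewrite (adj_degree1 (le1 x) xz xy).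
rewrite adj_sym in xy.
by apply: contra nzx => yz; rewrite (adj_degree1 (le1 y) yz xy).
Qed.

Lemma iso_2K2 : #|G| = 4 -> max_degree_le1 G -> 4 <= \sum_(x : G) degree x ->
  iso G (copies 2 (K_ 2)).
Proof.
move=> card4 le1 ge4.
have nbr (x : G) : exists y, adj x y.
  have : 0 < degree x.
    rewrite lt0n; apply/eqP => deg0; move: ge4; rewrite (bigD1 x) //= deg0.
    rewrite add0n leqNgt => /negP[].
    have: \sum_(i | i != x) degree i <= \sum_(i | i != x) 1 by apply: leq_sum.
    by rewrite sum1_card cardC1 card4.
  by case/card_gt0P=> y; rewrite inE; exists y.
have /card_gt0P[x _] : 0 < #|G| by rewrite card4.
have [y xy] := nbr x.
have [z] := @exists_notin G [:: x; y] ltac:(by rewrite card4).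
rewrite !inE negb_or => /andP[nzx nzy]; have [t zt] := nbr z.
have nbr1 (a b c : G) : adj a b -> b != c -> ~~ adj a c.
  by move=> ab nbc; apply: contra nbc => ac; rewrite (adj_degree1 (le1 a) ab ac).
have [yx tz] : adj y x /\ adj t z by rewrite adj_sym xy adj_sym zt.
have xz : ~~ adj x z by rewrite (nbr1 x y) // eq_sym.
have yz : ~~ adj y z by rewrite (nbr1 y x) // eq_sym.
have ntx : t != x by apply: contraNneq xz => <-.
have nty : t != y by apply: contraNneq yz => <-.
apply/iso_sym/embeds_iso; last by rewrite card_copies !card_ord card4.
by apply: (embeds_2K2 xy zt) => //; rewrite 1?eq_sym //;
  [apply: (nbr1 x y) | apply: (nbr1 y x)]; rewrite // eq_sym.
Qed.

Hypothesis le1c : max_degree_le1 (compl G).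

(** All degrees are positive. The vertex [x] has a single neighbour [y], so the third vertex can
    only be joined to [y]. *)
Lemma iso_P3 (x : G) : #|G| = 3 -> degree x <= 1 -> iso G (P_ 3).
Proof.
move=> card3 le1.
have nbr (y : G) : exists z, adj y z.
  have : 0 < degree y by have := max_degree_le1_compl_card y le1c; lia.
  by case/card_gt0P=> z; rewrite inE; exists z.
have [y xy] := nbr x; have nxy := adj_neq xy.
have [z] := @exists_notin G [:: x; y] ltac:(by rewrite card3).
rewrite !inE negb_or => /andP[nzx nzy].
have xz : ~~ adj x z.
  by apply: contra nzy => xz; rewrite (adj_degree1 le1 xz xy).
have [t zt] := nbr z.
have nxt : x != t by apply: contraNneq xz => ->; rewrite adj_sym.
have eq_yt : y = t.
  apply/eqP/negPn/negP => nyt.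
  have := @uniq_size_card G [:: x; y; z; t]; rewrite card3 /= !inE !negb_or.
  by rewrite nxy nxt nyt (adj_neq zt) ![_ == z]eq_sym nzx nzy => /(_ isT).
apply/iso_sym/embeds_iso; last by rewrite card_ord card3.
by apply: (embeds_P3 (x := x) (y := y) (z := z)); rewrite // ?eq_yt 1?adj_sym // eq_sym.
Qed.

(** Non-edges form a matching: if [x] and [z] are not adjacent, the other two vertices are adjacent
    to both, and degree 2 keeps them apart. The two non-edges are the diagonals. *)
Lemma iso_C4 : #|G| = 4 -> (forall x : G, degree x = 2) -> iso G (C_ 4).
Proof.
move=> card4 deg2; apply/iso_sym/embeds_iso; last by rewrite card_ord card4.
have /card_gt0P[x _] : 0 < #|G| by rewrite card4.
have: 0 < degree (x : compl G) by have := @degree_compl G x; rewrite card4 deg2; lia.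
case/card_gt0P=> z; rewrite inE => cxz; have /andP[nxz xz] := cxz.
have czx : @adj (compl G) z x by rewrite adj_sym.
have [y] := @exists_notin G [:: x; z] ltac:(by rewrite card4).
rewrite !inE negb_or => /andP[nyx nyz].
have [t] := @exists_notin G [:: x; z; y] ltac:(by rewrite card4).
rewrite !inE !negb_or => /and3P[ntx ntz nty].
have nbr (a b c : G) : @adj (compl G) a b -> c != a -> c != b -> adj c a.
  move=> ab nca ncb; apply/negPn/negP => nadj.
  have ac : @adj (compl G) a c by rewrite /= /compl_adj eq_sym nca adj_sym.
  by rewrite (adj_degree1 (le1c a) ac ab) eqxx in ncb.
have [yx yz] : adj y x /\ adj y z by split; [apply: nbr cxz _ _ | apply: nbr czx _ _].
have [tx tz] : adj t x /\ adj t z by split; [apply: nbr cxz _ _ | apply: nbr czx _ _].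
apply: (embeds_C4 (x := x) (y := y) (z := z) (t := t)) => //;
  rewrite 1?eq_sym 1?adj_sym //.
apply/negP => ty; have := deg2 y; rewrite /degree => deg2y.
have uniq_xzt : uniq [:: x; z; t].
  by rewrite /= !inE negb_or nxz eq_sym ntx eq_sym ntz.
have : #|[:: x; z; t]| <= 2.
  rewrite -deg2y; apply: subset_leq_card; apply/subsetP => u.
  by rewrite !inE => /or3P[] /eqP-> //; rewrite adj_sym.
by rewrite (card_uniqP uniq_xzt).
Qed.

End IsoSmall.

(** * Necessity: pairs of sequences that test monotonicity *)

Section Forward.

Variables F1 F2 : sgraph.
Hypothesis monF : dominance_monotone (pair_family F1 F2).

(** The form in which monotonicity gets contradicted: [D] is chosen to contain a member of the
    family, and [E] so that no graph with its degree sequence contains either. *)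
Lemma dominance_monotone_pair (D E : sgraph) :
  (forall x : D, 0 < degree x) -> (forall x : E, 0 < degree x) ->
  dominates (degree_seq D) (degree_seq E) ->
  (forall G, degree_seq G = degree_seq E -> ~ embeds F1 G /\ ~ embeds F2 G) ->
  ~ embeds F1 D /\ ~ embeds F2 D.
Proof.
move=> posD posE dom freeE.
have pos (G : sgraph) : (forall x : G, 0 < degree x) -> positive_terms (degree_seq G).
  by move=> posG; rewrite /positive_terms all_degree_seq; apply/forallP.
have : family_free (pair_family F1 F2) D.
  apply: (monF (d := degree_seq D) (e := degree_seq E)) => //.
  - by exists D.
  - exact: pos.
  - by exists E.
  - exact: pos.
  move=> G /freeE[no1 no2]; apply/family_freeP => H.
  by case=> /iso_sym/iso_embeds embH /(embeds_trans embH).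
move/family_freeP => freeD; split=> embD.
  by apply: freeD embD; left; exists id => //; exists id.
by apply: freeD embD; right; exists id => //; exists id.
Qed.

End Forward.

Lemma pair_family_sym F1 F2 H : pair_family F1 F2 H -> pair_family F2 F1 H.
Proof. by case; [right | left]. Qed.

Lemma dominance_monotone_sym F1 F2 :
  dominance_monotone (pair_family F1 F2) -> dominance_monotone (pair_family F2 F1).
Proof.
move=> monF d e sd pd se pe dom free G Gd S H /pair_family_sym.
apply: (monF d e) Gd S H => // G' Ge S' H' /pair_family_sym; exact: free.
Qed.

Lemma exists_superset (T : finType) (A : {set T}) k : #|A| <= k <= #|T| ->
  exists2 B : {set T}, A \subset B & #|B| = k.
Proof.
elim: k => [|k IHk]; first by rewrite leqn0 => /andP[/eqP]; exists A.
case/andP; rewrite leq_eqVlt => /predU1P[|leAk ltkT]; first by exists A.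
have [|B subAB cardB] := IHk; first by rewrite -ltnS leAk ltnW.
have [x] := @exists_notin T (enum B) ltac:(by rewrite -cardE cardB).
rewrite mem_enum => nBx; exists (x |: B); last by rewrite cardsU1 nBx cardB.
exact: subset_trans subAB (subsetUr _ _).
Qed.

Lemma max_degree_le1P (G : sgraph) :
  max_degree_le1 G \/ exists x : G, 1 < degree x.
Proof.
have [/forallP|/forallPn[x]] := boolP [forall x : G, degree x <= 1]; first by left.
by rewrite -ltnNge; right; exists x.
Qed.

Section Necessity.

Variables F1 F2 : sgraph.
Hypothesis monF : dominance_monotone (pair_family F1 F2).

(* A perfect matching is dominated by every graph without isolated vertices and
   with the same number of edges. *)
Lemma monotone_max_degree_le1 : max_degree_le1 F1 \/ max_degree_le1 F2.
Proof.
have [?|[x1 deg_x1]] := max_degree_le1P F1; first by left.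
have [?|[x2 deg_x2]] := max_degree_le1P F2; first by right.
(* The vertex joined to all of [F1] removes isolated vertices. Two copies of [A] have degree sum
   [2 * m], that of $mK_2$; since degrees in [A] are positive, $mK_2$ has at least as many
   vertices. *)
pose A := attach [set: F1]; pose m := \sum_(x : A) degree x.
pose D := copies 2 A; pose E := copies m (K_ 2).
have posA (u : A) : 0 < degree u.
  case: u => [u | x]; rewrite ?degree_attach_inl ?degree_attach_inr ?inE ?addn1 //.
  by rewrite cardsT; apply/card_gt0P; exists x1.
have degE (u : E) : degree u = 1 by rewrite degree_copies degree_K.
have [] := @dominance_monotone_pair F1 F2 monF D E.
- by move=> u; rewrite degree_copies.
- by move=> u; rewrite degE.
- apply: (@dominates_near_regular D E 1) => [||u]; last by rewrite degE.
    rewrite !card_copies card_ord mulnC leq_mul2r /= -sum1_card.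
    exact: leq_sum.
  by rewrite sum_degree_copies (sum_degree_regular degE) card_copies card_ord muln1 mulnC.
- move=> G eqGE.
  have le1G : max_degree_le1 G.
    by apply: (degree_seq_forall (p := fun d => d <= 1) eqGE) => u; rewrite degE.
  by split=> /max_degree_le1_embeds/(_ le1G) le1; [have := le1 x1 | have := le1 x2]; lia.
by case; apply: embeds_trans (embeds_attach _) (embeds_copies _ _).
Qed.

(* The complement of a matching is dominated by every graph of the same order
   and size. *)
Lemma monotone_max_degree_le1_compl :
  max_degree_le1 (compl F1) \/ max_degree_le1 (compl F2).
Proof.
have [?|[x1 deg_x1]] := max_degree_le1P (compl F1); first by left.
have [?|[x2 deg_x2]] := max_degree_le1P (compl F2); first by right.
(* Two copies of [compl F1] match the degree sum [2 * w] of $wK_2$. Isolated vertices bring both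
   graphs to order [2 * #|F1| + 2 * w], so their complements also agree in order and size. *)
pose w := \sum_(x : compl F1) degree x.
pose D' := dunion (copies 2 (compl F1)) (copies (2 * w) (K_ 1)).
pose E' := dunion (copies (2 * #|F1|) (K_ 1)) (copies w (K_ 2)).
have sumK1 a : \sum_(u : copies a (K_ 1)) degree u = 0.
  by apply: big1 => u _; rewrite degree_copies degree_K.
have eq_card' : #|D'| = #|E'|.
  by rewrite !card_dunion !card_copies !card_ord /=; lia.
have eq_sum' : \sum_(u : D') degree u = \sum_(u : E') degree u.
  rewrite !sum_degree_dunion !sumK1 !sum_degree_copies -/w addn0 add0n.
  by rewrite (sum_degree_regular (@degree_K 2)) card_ord muln1 mulnC.
have degE' (u : E') : degree u <= 1.
  by case: u => u; rewrite ?degree_dunion_inl ?degree_dunion_inr degree_copies degree_K.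
have F1_gt0 : 0 < #|F1| by apply/card_gt0P; exists x1.
have w_gt0 : 0 < w by rewrite /w (bigD1 x1) //=; lia.
have cardE' : #|E'| = 2 * #|F1| + w * 2.
  by rewrite card_dunion !card_copies !card_ord muln1.
have [] := @dominance_monotone_pair F1 F2 monF (compl D') (compl E').
- move=> u; have := @degree_compl D' u; rewrite eq_card' cardE'.
  have : degree (u : D') < #|F1|.
    case: (u) => v; rewrite ?degree_dunion_inl ?degree_dunion_inr degree_copies.
      exact: degree_lt.
    by rewrite degree_K.
  by lia.
- by move=> u; have := @degree_compl E' u; have := degE' u; lia.
- apply: (@dominates_near_regular (compl D') (compl E') #|E'|.-2) => [||u].
  + by rewrite -[#|compl D'|]/#|D'| eq_card'.
  + apply/eqP; rewrite -(eqn_add2l (\sum_(u : D') degree u)) {2}eq_sum'.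
    by rewrite !sum_degree_compl eq_card'.
  + by have := @degree_compl E' u; have := degE' u; lia.
- move=> G eqGE.
  (* As the order is fixed, the bound on complement degrees reads [#|E'| <= d + 2] on degrees, and
     so passes to every realization. *)
  have le1G : max_degree_le1 (compl G).
    move=> u; have cardG : #|G| = #|E'| := degree_seq_card eqGE.
    have : #|E'| <= degree (u : G) + 2.
      apply: (degree_seq_forall (p := fun d => #|E'| <= d + 2) eqGE) => v.
      by have := @degree_compl E' v; have := degE' v; lia.
    by have := @degree_compl G u; lia.
  by split=> /embeds_compl/max_degree_le1_embeds/(_ le1G) le1;
    [have := le1 x1 | have := le1 x2]; lia.
case; apply: embeds_trans (embeds_compl_compl _) (embeds_compl _).
exact: embeds_trans (embeds_copies _ _) (embeds_dunion_inl _ _).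
Qed.

Hypotheses (F1_gt2 : 2 < #|F1|) (F2_gt2 : 2 < #|F2|).
Hypotheses (le1_F1 : max_degree_le1 F1) (le1c_F2 : max_degree_le1 (compl F2)).

Let sum_F1 : \sum_(x : F1) degree x <= #|F1|.
Proof. by rewrite -sum1_card; apply: leq_sum => x _; apply: le1_F1. Qed.

(** The sequence of $P_3$ dominates that of $2K_2$, so some realization of the latter contains [F1],
    as maximum degree 1 excludes $P_3$. Its four vertices and degree sum 4 leave only two candidates
    of order at least 3. *)
Lemma monotone_P3 : iso F2 (P_ 3) ->
  iso F1 (dunion (K_ 2) (K_ 1)) \/ iso F1 (copies 2 (K_ 2)).
Proof.
move=> isoF2; pose E := copies 2 (K_ 2).
have degE (u : E) : degree u = 1 by rewrite degree_copies degree_K.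
have cardE : #|E| = 4 by rewrite card_copies card_ord.
have sumE : \sum_(u : E) degree u = 4 by rewrite (sum_degree_regular degE) cardE.
have [iso_2K2' | not_2K2] := boolP ((#|F1| == 4) && (4 <= \sum_(x : F1) degree x)).
  by right; case/andP: iso_2K2' => /eqP card4; apply: iso_2K2.
have [iso_K2K1' | not_K2K1] := boolP ((#|F1| == 3) && (0 < \sum_(x : F1) degree x)).
  by left; case/andP: iso_K2K1' => /eqP card3; apply: iso_K2K1.
have [] := @dominance_monotone_pair F1 F2 monF (P_ 3) E.
- by move=> i; rewrite degreeE !big_ord_recl big_ord0; case: i => [[|[|[|]]] ?].
- by move=> u; rewrite degE.
- apply: (@dominates_near_regular (P_ 3) E 1) => [||u]; last by rewrite degE.
    by rewrite card_ord cardE.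
  rewrite sumE; under eq_bigr do rewrite degreeE.
  by rewrite !big_ord_recl !big_ord0.
- move=> G eqGE.
  have le1G : max_degree_le1 G.
    by apply: (degree_seq_forall (p := fun d => d <= 1) eqGE) => u; rewrite degE.
  split=> [emb1 | emb2]; last first.
    apply: (@max_degree_le1_not_compl F2) => //.
    exact: max_degree_le1_embeds emb2 le1G.
  have := sum_degree_embeds_leq emb1 le1G.
  rewrite (sum_degree_fun id eqGE) (degree_seq_card eqGE) sumE cardE.
  move: not_2K2 not_K2K1; rewrite !negb_and; lia.
by move=> _ []; apply: iso_embeds.
Qed.

(** Test [F2] plus a pendant vertex against the cycle with one more vertex. Deleting a vertex from a
    2-regular graph lowers the degree sum by 4, too much to leave [F2]; so [F1] must embed, and
    counting edges allows this only for $K_2+K_1$ in five vertices. *)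
Lemma monotone_two_regular : #|F2| <= 4 -> (forall x : F2, degree x = 2) ->
  #|F2| = 4 /\ iso F1 (dunion (K_ 2) (K_ 1)).
Proof.
move=> F2_le4 deg2.
have [E [cardE degE]] : exists E : sgraph, #|E| = #|F2|.+1 /\ forall x : E, degree x = 2.
  have /orP[/eqP-> | /eqP->] : (#|F2| == 3) || (#|F2| == 4) by lia.
    by exists (C_ 4); split; [rewrite card_ord | apply: degree_C4].
  by exists (C_ 5); split; [rewrite card_ord | apply: degree_C5].
have sumE : \sum_(x : E) degree x = #|F2|.+1 * 2.
  by rewrite (sum_degree_regular degE) cardE.
have sumF2 : \sum_(x : F2) degree x = #|F2| * 2 by rewrite (sum_degree_regular deg2).
have /card_gt0P[x0 _] : 0 < #|F2| by lia.
have [/and3P[/eqP card4 /eqP card3 sum_gt0] | not_K2K1] :=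
    boolP [&& #|F2| == 4, #|F1| == 3 & 0 < \sum_(x : F1) degree x].
  by split; [| apply: iso_K2K1].
have [] := @dominance_monotone_pair F1 F2 monF (attach [set x0]) E.
- case=> u; rewrite ?degree_attach_inl ?cards1 // degree_attach_inr deg2 //.
- by move=> u; rewrite degE.
- apply: (@dominates_near_regular (attach [set x0]) E 2) => [||u]; last by rewrite degE.
    by rewrite card_attach cardE.
  by rewrite sum_degree_attach cards1 sumF2 sumE; lia.
- move=> G eqGE.
  have sumG := sum_degree_fun id eqGE; rewrite sumE in sumG.
  have cardG := degree_seq_card eqGE; rewrite cardE in cardG.
  have deg2G : forall x : G, degree x == 2.
    by apply: (degree_seq_forall (p := pred1 2) eqGE) => x; rewrite /= degE.
  split=> [emb1 | emb2].
    have le2G (x : G) : degree x <= 2 by rewrite (eqP (deg2G x)).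
    have := sum_degree_embeds_leq emb1 le2G; rewrite sumG cardG.
    move: not_K2K1 sum_F1; rewrite !negb_and; lia.
  have [x] := sum_degree_embeds_del1 emb2 cardG.
  by rewrite sumG sumF2 (eqP (deg2G x)); lia.
by move=> _ []; apply: embeds_attach.
Qed.

(* [D] is [F1] with a new vertex [v] of degree [k = maxn 3 b] adjacent to all of
   the [b] isolated vertices of [F1]; [E] results from [D] by replacing the edge
   [vx] by [xy], which moves one unit of degree from [v] to [y]. A realization of
   the degree sequence of [E] has too many edges and too small degrees to be [F1]
   plus one vertex. For [F2], all of whose degrees are at least 2, it has
   maximum degree 2 when [k = 3], and only two vertices of degree at least 2
   when [k > 3]. *)
Lemma monotone_degree_le2 (z : F2) : degree z <= 2.
Proof.
rewrite leqNgt; apply/negP => deg_z.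
pose I := [set x : F1 | degree x == 0].
have [S subIS cardS] : exists2 S : {set F1}, I \subset S & #|S| = maxn 3 #|I|.
  by apply: exists_superset; rewrite ?leq_maxr // geq_max F1_gt2 max_card.
have S_ge3 : 3 <= #|S| by rewrite cardS leq_maxl.
have degS (u : F1) : 1 <= degree u + (u \in S) <= 2.
  have := le1_F1 u; have [deg0 | deg_u] := posnP (degree u); last by case: (u \in S); lia.
  by rewrite (subsetP subIS u) ?inE deg0.
(* An isolated vertex of [F1] lies in [S] and serves as [y]. If there is none, [F1] is 1-regular,
   its order exceeds 3 by parity, and any vertex outside the 3-element [S] serves. *)
have [y deg_y] : exists y : F1, degree y + (y \in S) = 1.
  have [I0 | [y Iy]] := set_0Vmem I; last first.
    exists y; rewrite (subsetP subIS y Iy); move: Iy.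
    by rewrite inE => /eqP->.
  have gt0 (u : F1) : 0 < degree u.
    by rewrite lt0n; apply: contraFN (in_set0 u) => deg0; rewrite -I0 inE.
  have F1_gt3 : 3 < #|F1|.
    rewrite ltn_neqAle F1_gt2 andbT; apply/eqP => card3.
    by apply: (@one_regular_card3 F1).
  have [y] : exists y, y \notin enum S.
    by apply: exists_notin; rewrite -cardE cardS I0 cards0.
  rewrite mem_enum => /negbTE nSy; exists y; rewrite nSy.
  by have := le1_F1 y; have := gt0 y; lia.
(* Otherwise every vertex of [S] is [y] or a neighbour of [y], whence
   [#|S| <= degree y + (y \in S) = 1]. *)
have [x [Sx nxy nadj]] : exists x : F1, [/\ x \in S, x != y & ~~ adj x y].
  have [x /and3P[] | no_x] := pickP (fun x => [&& x \in S, x != y & ~~ adj x y]).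
    by exists x.
  have sub_S : S \subset (S :&: [set y]) :|: [set u | adj y u].
    apply/subsetP => u Su; rewrite !inE Su adj_sym /=.
    by have := no_x u; rewrite /= Su /=; case: (u == y) => //= /negbFE.
  have := leq_trans (subset_leq_card sub_S) (leq_card_setU _ _).
  rewrite -/(degree y) => S_le.
  have cardI : #|S :&: [set y]| = (y \in S).
    have [Sy|nSy] := boolP (y \in S); first by rewrite (setIidPr _) ?sub1set // cards1.
    by apply/eqP; rewrite cards_eq0 setI_eq0 disjoint_sym disjoints1.
  by move: S_le; rewrite cardI; lia.
pose D := attach S; pose E := @attach (add_edge x y) (S :\ x).
have cardSx : #|S| = #|S :\ x|.+1 by rewrite (cardsD1 x) Sx.
have degE (u : F1) : degree (inr u : E) = degree u + (u \in S) + (u == y).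
  rewrite degree_attach_inr degree_add_edge // !inE.
  by have [-> | _] := eqVneq u x; rewrite ?Sx; lia.
have sumD (g : nat -> nat) : \sum_(u : D) g (degree u) =
    g #|S| + (g 1 + \sum_(u : F1 | u != y) g (degree u + (u \in S))).
  rewrite big_sumType /= (eq_bigr _ (fun u _ => congr1 g (degree_attach_inl S u))).
  rewrite sum_nat_const card_unit mul1n; congr (_ + _).
  rewrite (bigD1 y) //= degree_attach_inr deg_y; congr (_ + _).
  by apply: eq_bigr => u _; rewrite degree_attach_inr.
have sumE (g : nat -> nat) : \sum_(u : E) g (degree u) =
    g #|S|.-1 + (g 2 + \sum_(u : F1 | u != y) g (degree u + (u \in S))).
  rewrite big_sumType /= (eq_bigr _ (fun u _ => congr1 g (degree_attach_inl (S :\ x) u))).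
  rewrite sum_nat_const card_unit mul1n cardSx; congr (_ + _).
  rewrite (bigD1 y) //= degE deg_y eqxx; congr (_ + _).
  by apply: eq_bigr => u /negbTE nuy; rewrite degE nuy addn0.
have eq_sum : \sum_(u : D) degree u = \sum_(u : E) degree u.
  by rewrite (sumD id) (sumE id) /=; lia.
have [] := @dominance_monotone_pair F1 F2 monF D E.
- case=> u; first by rewrite degree_attach_inl; lia.
  by rewrite degree_attach_inr; have := degS u; lia.
- case=> u; first by rewrite degree_attach_inl -ltnS -cardSx; lia.
  by rewrite degE; have := degS u; lia.
(* Only the degrees of the new vertex and of [y] differ: [#|S|] and 1 in [D], [#|S|.-1] and 2 in
   [E]. The claim is convexity of the truncated excess. *)
- apply: dominates_degree_seq eq_sum _ => t.
  by rewrite (sumD (subn^~ t)) (sumE (subn^~ t)); lia.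
- move=> G eqGE.
  have degG (u : G) : degree u < #|S|.
    apply: (degree_seq_forall (p := fun d => d < #|S|) eqGE) => -[v|v].
      by rewrite degree_attach_inl cardSx.
    rewrite degE; have [-> | _] := eqVneq v y; first by rewrite deg_y.
    by have := degS v; lia.
  split=> [emb1 | [f injf adjf]].
    (* The vertex [u] left over by [F1] would need degree [#|S|], above every degree of [G]. *)
    have [|u] := sum_degree_embeds_del1 emb1.
      by rewrite (degree_seq_card eqGE) card_attach.
    rewrite (sum_degree_fun id eqGE) -eq_sum sum_degree_attach.
    by have := degG u; lia.
  have S_ge4 : 3 < #|S|.
    exact: leq_ltn_trans (leq_trans deg_z (embeds_degree z injf adjf)) (degG _).
  (* Now [S] has more than 3 elements, so its prescribed size is that of [I]. Every vertex of [E]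
     but the new one and [y] then has degree at most 1, too few for the at least four vertices of
     [F2], each of degree at least 2. *)
  have eqIS : I = S by apply/eqP; rewrite eqEcard subIS cardS; lia.
  have F2_ge2 (w : F2) : 1 < degree w.
    by have := max_degree_le1_compl_card w le1c_F2; have := degree_lt z; lia.
  have : #|f @: [set: F2]| <= \sum_(u : G) (1 < degree u).
    rewrite -sum1_card [leqLHS]big_mkcond /=; apply: leq_sum => u _.
    case: ifP => // /imsetP[w _ ->].
    by rewrite (leq_trans (F2_ge2 w) (embeds_degree w injf adjf)).
  rewrite card_imset // cardsT (sum_degree_fun (fun d => 1 < d : nat) eqGE).
  rewrite (sumE (fun d => 1 < d : nat)) big1 => [|u _].
    by have := degree_lt z; lia.
  have [Su | nSu] := boolP (u \in S); last by have := le1_F1 u; lia.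
  by move: Su; rewrite -eqIS inE => /eqP->.
by case; apply: embeds_attach.
Qed.

(** Degrees in [F2] are at least [#|F2| - 2] and at most 2, so [#|F2| <= 4]. Either [F2] is
    2-regular, or a vertex of degree at most 1 brings the order down to 3 and [F2] is $P_3$. *)
Lemma monotone_matching_classification :
  (iso F2 (P_ 3) /\ (iso F1 (dunion (K_ 2) (K_ 1)) \/ iso F1 (copies 2 (K_ 2)))) \/
  (iso F2 (C_ 4) /\ iso F1 (dunion (K_ 2) (K_ 1))).
Proof.
have deg_ge (x : F2) : #|F2| <= degree x + 2 := max_degree_le1_compl_card x le1c_F2.
have F2_le4 : #|F2| <= 4.
  have /card_gt0P[x _] : 0 < #|F2| by lia.
  by have := deg_ge x; have := monotone_degree_le2 x; lia.
have [deg2 | /forallPn[x deg_x]] := boolP [forall x : F2, degree x == 2].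
  have {}deg2 (x : F2) : degree x = 2 by apply/eqP/(forallP deg2).
  have [card4 iso1] := monotone_two_regular F2_le4 deg2.
  by right; split; [apply: iso_C4|].
have le1_x : degree x <= 1 by have := monotone_degree_le2 x; lia.
have isoF2 : iso F2 (P_ 3) by apply: (@iso_P3 F2 le1c_F2 x) => //; have := deg_ge x; lia.
by left; split; [|apply: monotone_P3].
Qed.

End Necessity.

(** * From isomorphism types to families, and the equivalence *)

Lemma same_family_pair F1 F2 H1 H2 : iso F1 H1 -> iso F2 H2 ->
  same_family (pair_family F1 F2) (pair_family H1 H2).
Proof.
move=> iso1 iso2 H; split=> -[] isoH.
- by left; apply: iso_trans isoH iso1.
- by right; apply: iso_trans isoH iso2.
- by left; apply: iso_trans isoH (iso_sym iso1).
- by right; apply: iso_trans isoH (iso_sym iso2).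
Qed.

Lemma same_family_swap F1 F2 F : same_family (pair_family F2 F1) F ->
  same_family (pair_family F1 F2) F.
Proof. by move=> same H; rewrite -same; split; apply: pair_family_sym. Qed.

Lemma monotone_matching_family F1 F2 :
  dominance_monotone (pair_family F1 F2) -> 2 < #|F1| -> 2 < #|F2| ->
  max_degree_le1 F1 -> max_degree_le1 (compl F2) ->
  same_family (pair_family F1 F2) (pair_family (dunion (K_ 2) (K_ 1)) (P_ 3)) \/
  same_family (pair_family F1 F2) (pair_family (dunion (K_ 2) (K_ 1)) (C_ 4)) \/
  same_family (pair_family F1 F2) (pair_family (copies 2 (K_ 2)) (P_ 3)).
Proof.
move=> monF gt1 gt2 le1 le1c.
case: (monotone_matching_classification monF gt1 gt2 le1 le1c) => -[iso2].
- by case=> iso1; [left | right; right]; apply: same_family_pair.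
- by move=> iso1; right; left; apply: same_family_pair.
Qed.

Theorem theorem4p2 (F1 F2 : sgraph)
    (F1_nonempty : 0 < #|F1|) (F2_nonempty : 0 < #|F2|)
    (F1_F2_noniso : ~ iso F1 F2) :
  dominance_monotone (pair_family F1 F2) <->
  (pair_family F1 F2 (K_ 1) \/
   pair_family F1 F2 (copies 2 (K_ 1)) \/
   pair_family F1 F2 (K_ 2)) \/
  (same_family (pair_family F1 F2) (pair_family (dunion (K_ 2) (K_ 1)) (P_ 3)) \/
   same_family (pair_family F1 F2) (pair_family (dunion (K_ 2) (K_ 1)) (C_ 4)) \/
   same_family (pair_family F1 F2) (pair_family (copies 2 (K_ 2)) (P_ 3))).
Proof.
split=> [monF | inF]; last first.
  have iso_refl H : iso H H by exists id => //; exists id.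
  apply: complete_split_family; case: inF => [|same]; [by left | right].
  case: same => [same | [same | same]]; [left | left | right]; split.
  - by apply/same; left.
  - by left; apply/same; right.
  - by apply/same; left.
  - by right; apply/same; right.
  - by apply/same; left.
  - by apply/same; right.
have [lt1 | gt1] := ltnP #|F1| 3.
  by left; case: (card_small F1_nonempty lt1) => /iso_sym isoF;
    [left | right; left | right; right]; left.
have [lt2 | gt2] := ltnP #|F2| 3.
  by left; case: (card_small F2_nonempty lt2) => /iso_sym isoF;
    [left | right; left | right; right]; right.
right; have swap := same_family_swap; have monF' := dominance_monotone_sym monF.
(* Two of the four combinations give both bounds to one graph, which is impossible; the other two
   differ by exchanging [F1] and [F2]. *)
case: (monotone_max_degree_le1 monF) (monotone_max_degree_le1_compl monF)
  => le1 [le1c|le1c].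
- by case: (max_degree_le1_not_compl gt1 le1 le1c).
- exact: monotone_matching_family.
- case: (monotone_matching_family monF' gt2 gt1 le1 le1c) => [same|[same|same]].
  + by left; apply: swap.
  + by right; left; apply: swap.
  + by right; right; apply: swap.
- by case: (max_degree_le1_not_compl gt2 le1 le1c).
Qed.
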